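(* Let $X$ be a Banach space that contains the spaces $\ell_\infty^n$ quasi-isometrically uniformly, i.e. there exist constants $L>0$ and $C\ge 0$, independent of $n$, such that for every $n\in\mathbb{N}$ there is a map $f_n\colon \ell_\infty^n\to X$ satisfying $$L^{-1}\|v-w\|_\infty-C\le\|f_n(v)-f_n(w)\|_X\le L\|v-w\|_\infty+C\qquad\text{for all }v,w\in\ell_\infty^n.$$ Then $X$ does not admit a quasi-isometric embedding into any uniformly convex Banach space.
   Context: $\ell_\infty^n$ is $\mathbb{R}^n$ with the norm $\|v\|_\infty=\max_i|v_i|$. The maps $f_n$ are not assumed to be linear or continuous. A map $f\colon X\to Y$ between metric spaces is a quasi-isometric embedding if there are constants $L>0$, $C\ge 0$ such that $L^{-1}d_X(x,y)-C\le d_Y(f(x),f(y))\le L\,d_X(x,y)+C$ for all $x,y\in X$. *)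

(* Defs.v *)
From mathcomp Require Import all_boot all_order all_algebra.
From mathcomp Require Import all_classical all_reals all_analysis.

Set Implicit Arguments.
Unset Strict Implicit.
Unset Printing Implicit Defensive.

Import Order.TTheory GRing.Theory Num.Theory.
Import numFieldNormedType.Exports.

Local Open Scope ring_scope.

Definition qi_embedding_with (R : realType) (V W : normedModType R)
    (L C : R) (f : V -> W) : Prop :=
  forall x y : V,
    L^-1 * `|x - y| - C <= `|f x - f y| /\ `|f x - f y| <= L * `|x - y| + C.

Definition quasi_isometric_embedding (R : realType) (V W : normedModType R)
    (f : V -> W) : Prop :=
  exists L C : R, [/\ 0 < L, 0 <= C & qi_embedding_with L C f].

(* The library norm on ['rV[R]_n] is the maximum of the absolute values of the
   entries ([mx_normrE]), so ['rV[R]_n] is the space l_infty^n. *)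
Definition contains_linfty_qi_uniformly (R : realType) (X : normedModType R)
    : Prop :=
  exists L C : R, [/\ 0 < L, 0 <= C &
    forall n : nat, exists f : 'rV[R]_n -> X, qi_embedding_with L C f].

Definition uniformly_convex (R : realType) (Y : normedModType R) : Prop :=
  forall eps : R, 0 < eps -> eps <= 2 ->
    exists2 delta : R, 0 < delta &
      forall x y : Y, `|x| = 1 -> `|y| = 1 -> eps <= `|x - y| ->
        `|2^-1 *: (x + y)| <= 1 - delta.

(* Main.v *)
(** Composing the given maps with an embedding [X -> Y] yields maps
    [g : l_infty^n -> Y] that are quasi-isometric embeddings with constants
    [A], [C] independent of [n].  Let [x], [y] be points of [l_infty^n] at
    distance [t] that agree in some coordinate [i].  The points
    [m+- = (x + y)/2 +- (t/2) e_i] are both metric midpoints of [x] and [y],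
    and they are at distance [t] from each other.  In a uniformly convex space
    approximate midpoints are close together, so if [t] is large, one of the
    four pairs formed by [x] or [y] and [m+] or [m-] is stretched by [g] at least
    [1 + delta] times as much as [x], [y], with [delta] depending only on [A]
    and [Y].  The new pair is at distance [t/2] and differs in at most one more
    coordinate, so the step can be iterated [n - 1] times from a pair differing
    in a single coordinate; for [n] large the stretch exceeds the upper bound. *)

Require Import Defs.
From mathcomp Require Import all_boot all_order all_algebra.
From mathcomp Require Import all_classical all_reals all_analysis.
From mathcomp Require Import ring lra.

Set Implicit Arguments.
Unset Strict Implicit.
Unset Printing Implicit Defensive.

Import Order.TTheory GRing.Theory Num.Theory.
Import numFieldNormedType.Exports.

Local Open Scope ring_scope.

(** * Constants of a composite embedding *)

Lemma qi_embedding_with_comp (R : realType) (U V W : normedModType R)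
    (L1 C1 L2 C2 : R) (f : U -> V) (g : V -> W) :
  0 < L2 -> 0 <= C1 ->
  qi_embedding_with L1 C1 f -> qi_embedding_with L2 C2 g ->
  qi_embedding_with (L1 * L2) ((L2 + L2^-1) * C1 + C2) (g \o f).
Proof.
move=> L2_gt0 C1_ge0 qf qg x y /=.
have [fl fu] := qf x y; have [gl gu] := qg (f x) (f y).
have L2V_gt0 : 0 < L2^-1 by rewrite invr_gt0.
have p1 : 0 <= L2 * C1 by rewrite mulr_ge0 // ltW.
have p2 : 0 <= L2^-1 * C1 by rewrite mulr_ge0 // ltW.
have := ler_wpM2l (ltW L2_gt0) fu; have := ler_wpM2l (ltW L2V_gt0) fl.
rewrite invfM !mulrDr !mulrDl mulrN !mulrA.
rewrite [L2 * L1]mulrC [L2^-1 * L1^-1]mulrC.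
by move=> l u; split; lra.
Qed.

(** * Approximate midpoints in a uniformly convex space *)

Lemma dist_normalize (R : realType) (V : normedModType R) (rho : R) (u : V) :
  u != 0 -> 0 < rho -> `|u| <= rho ->
  `|(`|u|^-1 *: u) - rho^-1 *: u| = 1 - rho^-1 * `|u|.
Proof.
move=> u0 rho0 ule; have nu0 : 0 < `|u| by rewrite normr_gt0.
rewrite -scalerBl normrZ ger0_norm; last by rewrite subr_ge0 lef_pV2.
by rewrite mulrBl mulVf // gt_eqF.
Qed.

(** For [u = a - p] and [v = a - q], the bounds at [b] force the norms of [u], [v] and [(u + v) / 2]
    to be at least [d - rho], while those at [a] keep [u] and [v] within [rho]. So the normalized
    vectors have a sum of norm almost 2, hence are close, and [u - v = q - p]. *)
Lemma uniformly_convex_midpoints (R : realType) (Y : normedModType R) :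
  uniformly_convex Y -> forall eps : R, 0 < eps -> eps <= 2 ->
  exists2 delta : R, 0 < delta &
    forall a b p q : Y, 0 < `|a - b| ->
      `|a - p| <= (1 + delta) * (`|a - b| / 2) ->
      `|p - b| <= (1 + delta) * (`|a - b| / 2) ->
      `|a - q| <= (1 + delta) * (`|a - b| / 2) ->
      `|q - b| <= (1 + delta) * (`|a - b| / 2) ->
      `|p - q| <= 2 * eps * `|a - b|.
Proof.
move=> ucY eps eps0 eps2; have [d0 d0_gt0 ucd] := ucY _ eps0 eps2.
(* The normalized sum will have norm at least [2 - 8 * delta], so [d0 / 8] puts its half above
   [1 - d0]. Normalizing costs [4 * delta], at most [eps], in the distance. The bound [4^-1] gives
   [rho < d], so [u] and [v] are nonzero. *)
pose delta := Num.min (Num.min (d0 / 8) (eps / 4)) (4^-1 : R).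
have delta_gt0 : 0 < delta by rewrite !lt_min !divr_gt0 ?invr_gt0 //=.
have [dd0 deps d1] : [/\ delta <= d0 / 8, delta <= eps / 4 & delta <= 4^-1].
  by split; rewrite /delta !ge_min lexx ?orbT.
exists delta => // a b p q; set d := `|a - b| => d_gt0 ap pb aq qb.
pose rho := (1 + delta) * (d / 2); pose u := a - p; pose v := a - q.
have rho_gt0 : 0 < rho by rewrite mulr_gt0 ?divr_gt0 // addr_gt0.
have rhoE : rho * (1 - 2 * delta) <= d - rho by rewrite /rho; nra.
have ul : d - rho <= `|u|.
  have : d <= `|u| + `|p - b| by rewrite /d /u; apply: ler_distD.
  by move: pb; rewrite -/rho; lra.
have vl : d - rho <= `|v|.
  have : d <= `|v| + `|q - b| by rewrite /d /v; apply: ler_distD.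
  by move: qb; rewrite -/rho; lra.
have w_ge : 2 * (d - rho) <= `|u + v|.
  have d2 : 2 * d <= `|u + v| + (`|p - b| + `|q - b|).
    rewrite /d mulr_natl -normrMn mulr2n.
    have -> : (a - b) + (a - b) = (u + v) + ((p - b) + (q - b)).
      by rewrite [RHS]addrACA /u /v !addrA !subrK.
    by rewrite (le_trans (ler_normD _ _)) // lerD2l ler_normD.
  by move: pb qb; rewrite -/rho; lra.
have ur : `|u| <= rho by []; have vr : `|v| <= rho by [].
have u_gt0 : 0 < `|u| by nra.
have v_gt0 : 0 < `|v| by nra.
have u0 : u != 0 by rewrite -normr_gt0.
have v0 : v != 0 by rewrite -normr_gt0.
have scale_le c : d - rho <= c -> 1 - 2 * delta <= rho^-1 * c.
  by move=> dc; rewrite [_^-1 * _]mulrC ler_pdivlMr // [_ * rho]mulrC; apply: le_trans dc.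
pose u' := `|u|^-1 *: u; pose v' := `|v|^-1 *: v.
have u'1 : `|u'| = 1 by rewrite normrZ normfV normr_id mulVf // gt_eqF.
have v'1 : `|v'| = 1 by rewrite normrZ normfV normr_id mulVf // gt_eqF.
have uu' : `|u' - rho^-1 *: u| <= 2 * delta.
  by rewrite dist_normalize //; have := scale_le _ ul; lra.
have vv' : `|v' - rho^-1 *: v| <= 2 * delta.
  by rewrite dist_normalize //; have := scale_le _ vl; lra.
have rhoV_ge0 : 0 <= rho^-1 by rewrite invr_ge0 ltW.
have sum_ge : 2 - 8 * delta <= `|u' + v'|.
  have : rho^-1 * `|u + v| <= `|u' + v'| + (2 * delta + 2 * delta).
    rewrite -{1}(ger0_norm rhoV_ge0) -normrZ scalerDr.
    apply: le_trans (lerD (lexx _) (lerD uu' vv')).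
    apply: le_trans (lerD (lexx _) (ler_normD _ _)).
    apply: le_trans (ler_normB _ _).
    by rewrite [X in _ - X]addrACA -opprD opprB [X in _ <= `|X|]addrC subrK.
  by have := scale_le (`|u + v| / 2); rewrite ler_pdivlMr // mulrC => /(_ w_ge); lra.
have diff_le : rho^-1 * `|p - q| <= `|u' - v'| + 4 * delta.
  have -> : p - q = v - u by rewrite /u /v opprB [RHS]addrC addrA subrK.
  rewrite -{1}(ger0_norm rhoV_ge0) -normrZ scalerBr.
  have := ler_distD v' (rho^-1 *: v) (rho^-1 *: u).
  have := ler_distD u' v' (rho^-1 *: u).
  by rewrite (distrC _ v') (distrC v' u'); lra.
have uv_lt : `|u' - v'| < eps.
  rewrite ltNge; apply/negP => /(ucd _ _ u'1 v'1).
  by rewrite normrZ ger0_norm //; lra.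
have : rho^-1 * `|p - q| <= 2 * eps by lra.
rewrite mulrC ler_pdivrMr // => /le_trans; apply.
by rewrite ler_wpM2l ?mulr_ge0 ?ltW // /rho; nra.
Qed.

(** * Midpoints for the maximum norm *)

Lemma le_linfty_norm (R : realType) (n : nat) (x : 'rV[R]_n) (j : 'I_n) :
  `|x 0 j| <= `|x|.
Proof.
rewrite [leRHS]/Num.Def.normr /= mx_normrE.
exact: (le_bigmax _ (fun ij : 'I_1 * 'I_n => `|x ij.1 ij.2|) (0, j)).
Qed.

Lemma linfty_norm_eq (R : realType) (n : nat) (i : 'I_n) (x : 'rV[R]_n)
    (t : R) :
  `|x 0 i| = t -> (forall j, `|x 0 j| <= t) -> `|x| = t.
Proof.
move=> xi xt; have t_ge0 : 0 <= t by rewrite -xi.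
apply/eqP; rewrite eq_le -{2}xi le_linfty_norm andbT.
rewrite [leLHS]/Num.Def.normr /= mx_normrE; apply: bigmax_le => //= -[k j] _.
by rewrite ord1.
Qed.

(** Averaged coordinates are within [t / 2] of both ends, so the free coordinate [i] can move by
    [t / 2] either way at no cost. Averaging preserves every other agreement of [x] and [y], which
    lets the construction be repeated. *)
Lemma linfty_split_pair (R : realType) (n : nat) (i : 'I_n) (x y : 'rV[R]_n) :
  x 0 i = y 0 i ->
  exists p q : 'rV[R]_n,
    [/\ forall j, j != i -> x 0 j = y 0 j -> p 0 j = x 0 j /\ q 0 j = x 0 j,
        `|x - p| = `|x - y| / 2 /\ `|p - y| = `|x - y| / 2,
        `|x - q| = `|x - y| / 2 /\ `|q - y| = `|x - y| / 2
      & `|p - q| = `|x - y|].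
Proof.
move=> xyi; set t := `|x - y|; have t_ge0 : 0 <= t by exact: normr_ge0.
pose m s : 'rV[R]_n :=
  \row_j (if j == i then x 0 j + s else (x 0 j + y 0 j) / 2).
have xy_le j : `|x 0 j - y 0 j| <= t.
  by have := le_linfty_norm (x - y) j; rewrite !mxE.
have xm s : `|s| = t / 2 -> `|x - m s| = t / 2.
  move=> st; apply: (@linfty_norm_eq _ _ i) => [|j]; rewrite !mxE.
    by rewrite eqxx opprD addrA subrr sub0r normrN.
  case: eqP => _; first by rewrite opprD addrA subrr sub0r normrN st.
  have -> : x 0 j - (x 0 j + y 0 j) / 2 = (x 0 j - y 0 j) / 2 by field.
  by rewrite normrM [`|2^-1|]ger0_norm // ler_wpM2r.
have my s : `|s| = t / 2 -> `|m s - y| = t / 2.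
  move=> st; apply: (@linfty_norm_eq _ _ i) => [|j]; rewrite !mxE.
    by rewrite eqxx xyi addrC addKr.
  case: eqP => [->|_]; first by rewrite xyi addrC addKr st.
  have -> : (x 0 j + y 0 j) / 2 - y 0 j = (x 0 j - y 0 j) / 2 by field.
  by rewrite normrM [`|2^-1|]ger0_norm // ler_wpM2r.
have tp : `|t / 2| = t / 2 by rewrite ger0_norm // divr_ge0.
have tn : `|- (t / 2)| = t / 2 by rewrite normrN.
exists (m (t / 2)), (m (- (t / 2))); split.
- by move=> j /negPf ji xyj; rewrite !mxE ji -xyj; split; field.
- by split; [apply: xm|apply: my].
- by split; [apply: xm|apply: my].
apply: (@linfty_norm_eq _ _ i) => [|j]; rewrite !mxE.
  rewrite eqxx; have -> : x 0 i + t / 2 - (x 0 i - t / 2) = t by field.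
  by rewrite ger0_norm.
case: eqP => _; last by rewrite subrr normr0.
have -> : x 0 j + t / 2 - (x 0 j - t / 2) = t by field.
by rewrite ger0_norm.
Qed.

(** * One stretching step and its iteration *)

Lemma qi_embedding_stretched_pair (R : realType) (Y : normedModType R)
    (A C : R) :
  uniformly_convex Y -> 0 < A ->
  exists2 delta : R, 0 < delta &
    forall (n : nat) (g : 'rV[R]_n -> Y) (i : 'I_n) (x y : 'rV[R]_n),
      qi_embedding_with A C g -> x 0 i = y 0 i -> 0 < `|x - y| ->
      C <= A * `|x - y| -> C <= A^-1 / 2 * `|x - y| ->
      exists x' y' : 'rV[R]_n,
        [/\ forall j, j != i -> x 0 j = y 0 j -> x' 0 j = y' 0 j,
            `|x' - y'| = `|x - y| / 2
          & (1 + delta) * (`|g x - g y| / 2) <= `|g x' - g y'|].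
Proof.
move=> ucY A_gt0; pose B := A^-1.
have B_gt0 : 0 < B by rewrite invr_gt0.
have AB : A * B = 1 by rewrite mulfV // gt_eqF.
(* The images of [x] and [y] are at most [2 * A * t] apart, where [t] is the distance of [x] and
   [y]. This [eps] therefore puts the images of [p] and [q] within [B * t / 4], against the lower
   bound [B * t - C >= B * t / 2]. *)
pose eps : R := Num.min 2 (B ^+ 2 / 16).
have eps_gt0 : 0 < eps by rewrite lt_min ltr0n divr_gt0 ?exprn_gt0.
have eps2 : eps <= 2 by rewrite ge_min lexx.
have epsB : eps <= B ^+ 2 / 16 by rewrite ge_min lexx orbT.
have [delta delta_gt0 mid] := uniformly_convex_midpoints ucY eps_gt0 eps2.
exists delta => // n g i x y qg xyi t_gt0 CA CB.
have [p [q [pq_eq [xp py] [xq qy] pq]]] := linfty_split_pair xyi.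
apply: contrapT => no_pair.
have short (x' y' : 'rV[R]_n) :
    (forall j, j != i -> x 0 j = y 0 j -> x' 0 j = y' 0 j) ->
    `|x' - y'| = `|x - y| / 2 ->
    `|g x' - g y'| <= (1 + delta) * (`|g x - g y| / 2).
  move=> eq' dist'; rewrite leNgt; apply/negP => /ltW long.
  by apply: no_pair; exists x', y'.
have [dl du] := qg x y; have [pql _] := qg p q.
move: dl du pql; rewrite pq -/B => dl du pql; move: CB; rewrite -/B => CB.
have Bt_gt0 := mulr_gt0 B_gt0 t_gt0.
have d_gt0 : 0 < `|g x - g y| by lra.
have : `|g p - g q| <= 2 * eps * `|g x - g y|.
  apply: mid => //; apply: short => // j ji xyj;
    by have [pj qj] := pq_eq j ji xyj; rewrite ?pj ?qj.
have : eps * `|g x - g y| <= B * `|x - y| / 8.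
  have <- : B ^+ 2 / 16 * (2 * A * `|x - y|) = B * `|x - y| / 8.
    transitivity (A * B * (B * `|x - y| / 8)); last by rewrite AB mul1r.
    by field.
  by apply: ler_pM => //; [exact: ltW|lra].
lra.
Qed.

(** Bernoulli's inequality in the form [delta * k <= (1 + delta) ^+ k], with the Archimedean
    property. *)
Lemma expr1D_unbounded (R : realType) (delta M : R) :
  0 < delta -> exists N : nat, M < (1 + delta) ^+ N.
Proof.
move=> delta_gt0; exists (Num.bound `|M / delta|).
apply: (@lt_le_trans _ _ (delta * (Num.bound `|M / delta|)%:R)).
  rewrite mulrC -ltr_pdivrMr //.
  exact: le_lt_trans (ler_norm _) (archi_boundP (normr_ge0 _)).
elim: (Num.bound _) => [|k IH]; first by rewrite mulr0.
have : 1 <= (1 + delta) ^+ k by rewrite exprn_ege1 // lerDl ltW.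
by rewrite exprS -natr1; nra.
Qed.

Lemma linfty_not_qi_uniformly_convex (R : realType) (Y : normedModType R)
    (A C : R) :
  uniformly_convex Y -> 0 < A -> 0 <= C ->
  exists n : nat, forall g : 'rV[R]_n -> Y, ~ qi_embedding_with A C g.
Proof.
move=> ucY A_gt0 C_ge0.
have [delta delta_gt0 stretch] := qi_embedding_stretched_pair C ucY A_gt0.
(* The initial stretch [A^-1 / 2] times [4 * A ^+ 2] is [2 * A], the largest stretch possible once
   [C <= A * t]. *)
have [N AN] := expr1D_unbounded (4 * A ^+ 2) delta_gt0.
exists N.+1 => g qg.
have B_gt0 : 0 < A^-1 by rewrite invr_gt0.
have AB : A * A^-1 = 1 by rewrite mulfV // gt_eqF.
(* The final distance: the first two terms make the additive constant negligible for lower and upper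
   bound, the last makes [t0] positive. *)
pose t0 := 2 * A * C + A^-1 * C + 1.
have AC_ge0 : 0 <= A * C by rewrite mulr_ge0 // ltW.
have BC_ge0 : 0 <= A^-1 * C by rewrite mulr_ge0 // ltW.
have t0_ge1 : 1 <= t0 by rewrite /t0; lra.
have CA t : t0 <= t -> C <= A * t.
  move=> t0t; have : A * t0 <= A * t by rewrite ler_pM2l.
  by apply: le_trans; rewrite /t0; nra.
have CB t : t0 <= t -> C <= A^-1 / 2 * t.
  move=> t0t; have : A^-1 / 2 * t0 <= A^-1 / 2 * t.
    by rewrite ler_wpM2l // divr_ge0 ?ltW.
  by apply: le_trans; rewrite /t0; nra.
have t0_le k : t0 <= 2 ^+ k * t0.
  by rewrite ler_peMl ?exprn_ege1 //; lra.
(* Starting at [2 ^+ N * t0], all [N] halvings stay at or above [t0]. Step [k.+1] spends coordinate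
   [k.+1]; coordinate 0 carries the initial difference, hence dimension [N.+1]. *)
have iter k : (k <= N)%N -> exists x y : 'rV[R]_N.+1,
    [/\ forall j : 'I_N.+1, (k < j)%N -> x 0 j = y 0 j,
        `|x - y| = 2 ^+ (N - k) * t0
      & (1 + delta) ^+ k * (A^-1 / 2 * `|x - y|) <= `|g x - g y|].
  elim: k => [_|k IH kN].
    pose x : 'rV[R]_N.+1 := \row_j (if j == 0 then 2 ^+ N * t0 else 0).
    have nx : `|x - 0| = 2 ^+ N * t0.
      have t_ge0 : 0 <= 2 ^+ N * t0 by rewrite mulr_ge0 ?exprn_ge0 //; lra.
      rewrite subr0; apply: (@linfty_norm_eq _ _ 0) => [|j]; rewrite mxE.
        by rewrite eqxx ger0_norm.
      by case: eqP => _; rewrite ?normr0 ?ger0_norm.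
    exists x, 0; rewrite nx subn0; split=> //.
      by move=> j j_gt0; rewrite !mxE -val_eqE /= gtn_eqF.
    have [+ _] := qg x 0; rewrite nx => /(le_trans _); apply.
    by have := CB _ (t0_le N); lra.
  have [x [y [xy_eq dxy gxy]]] := IH (ltnW kN).
  have t0xy : t0 <= `|x - y| by rewrite dxy.
  have [||||x' [y' [xy'_eq dxy' gxy']]] :=
    stretch _ g (Ordinal (kN : k.+1 < N.+1)%N) x y qg.
  - exact: xy_eq.
  - by lra.
  - exact: CA.
  - exact: CB.
  exists x', y'; split.
  - move=> j kj; apply: xy'_eq; last by apply: xy_eq; apply: ltnW.
    by rewrite -val_eqE /= gtn_eqF.
  - by rewrite dxy' dxy -(subnSK kN) exprS; field.
  apply: le_trans gxy'; rewrite dxy' exprS -mulrA ler_pM2l; last by lra.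
  by lra.
have [x [y [_ dxy gxy]]] := iter N (leqnn N).
have [_ gu] := qg x y.
move: dxy; rewrite subnn mul1r => dxy.
have t_gt0 : 0 < A^-1 / 2 * t0 by rewrite mulr_gt0 ?divr_gt0 //; lra.
have := CA _ (lexx t0); move: gxy gu; rewrite dxy => gxy gu Ct0.
have : 4 * A ^+ 2 * (A^-1 / 2 * t0) < (1 + delta) ^+ N * (A^-1 / 2 * t0).
  by rewrite ltr_pM2r.
have -> : 4 * A ^+ 2 * (A^-1 / 2 * t0) = 2 * A * t0.
  by field; rewrite gt_eqF.
lra.
Qed.

Theorem proposition6 (R : realType) (X : completeNormedModType R) :
  contains_linfty_qi_uniformly X ->
  forall Y : completeNormedModType R, uniformly_convex Y ->
    ~ (exists f : X -> Y, quasi_isometric_embedding f).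
Proof.
move=> [L1 [C1 [L1_gt0 C1_ge0 emb]]] Y ucY [f [L2 [C2 [L2_gt0 C2_ge0 qf]]]].
have L_gt0 : 0 < L1 * L2 by rewrite mulr_gt0.
have C_ge0 : 0 <= (L2 + L2^-1) * C1 + C2.
  by rewrite addr_ge0 // mulr_ge0 // addr_ge0 // ?invr_ge0 ltW.
(* The dimension can be chosen after the composite constants because these do not depend on it. *)
have [n no_emb] := linfty_not_qi_uniformly_convex ucY L_gt0 C_ge0.
have [h qh] := emb n.
exact: no_emb (qi_embedding_with_comp L2_gt0 C1_ge0 qh qf).
Qed.
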